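(* Let $n\ge 2$ and let $q$ be a complex number with $q\neq -1$. Then, as a vector space over $\mathbb{C}$, $\mathfrak{A}_n(q)$ has dimension $$\dim_{\mathbb{C}}\mathfrak{A}_n(q)=\frac{n!}{2}.$$
   Context: $\mathcal{H}_n(q)$ is the unital associative $\mathbb{C}$-algebra with generators $g_1,\ldots,g_{n-1}$ and relations $g_i^2=(q-1)g_i+q$ for $1\le i\le n-1$; $g_ig_{i+1}g_i=g_{i+1}g_ig_{i+1}$ for $1\le i\le n-2$; $g_ig_j=g_jg_i$ for $|i-j|\ge 2$. For $q\ne -1$ put $f_i=\frac{2g_i-(q-1)}{q+1}$, $1\le i\le n-1$. For $n\ge 3$, $\mathfrak{A}_n(q)$ is the unital subalgebra of $\mathcal{H}_n(q)$ generated by the elements $f_1f_{i+1}$, $1\le i\le n-2$; $\mathfrak{A}_2(q)$ is the subalgebra of $\mathcal{H}_2(q)$ generated by the unit element. *)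

(* Defs.v *)
From HB Require Import structures.
From mathcomp Require Import all_boot all_order all_algebra.
From mathcomp Require Import boolp classical_sets reals.
From mathcomp Require Import complex monalg ring.

Set Implicit Arguments.
Unset Strict Implicit.
Unset Printing Implicit Defensive.

Import GRing.Theory.
Local Open Scope classical_set_scope.
Local Open Scope ring_scope.
Local Open Scope quotient_scope.

Definition two_sided_ideal (A : nzRingType) (J : set A) : Prop :=
  [/\ J 0, (forall x y, J x -> J y -> J (x + y))
    & (forall a b x, J x -> J (a * x * b))].

Definition ideal_gen (A : nzRingType) (S : set A) : set A :=
  smallest (@two_sided_ideal A) S.

Lemma ideal_gen_ideal (A : nzRingType) (S : set A) :
  two_sided_ideal (ideal_gen S).
Proof.
split=> [J [[]] //|x y xJ yJ J JS|a b x xJ J JS]; case: (JS) => -[_ JD JM] _.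
  by apply: JD; [apply: xJ | apply: yJ].
by apply: JM; apply: xJ.
Qed.

Fact scaler_central (F : fieldType) (A : lalgType F) (c : F) (z a b : A) :
  (forall x, c *: x = z * x) -> z * a = a * z -> c *: (a * b) = a * (c *: b).
Proof. by move=> cE za; rewrite !cE !mulrA za. Qed.

Section Presentation.
Variables (F : fieldType) (X : choiceType).

(* {malg F[{fmonom X}]}, the monoid algebra of the free monoid on X, is the
   free unital associative F-algebra on X. *)
Definition free_gen (x : X) : {malg F[{fmonom X}]} := << fmu x >>.

Variable rels : set {malg F[{fmonom X}]}.

Definition rel_ideal : {pred {malg F[{fmonom X}]}} :=
  fun a => `[< ideal_gen rels a >].

Fact rel_ideal0 : 0 \in rel_ideal.
Proof. by apply/asboolP; case: (ideal_gen_ideal rels). Qed.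

Fact rel_idealD : {in rel_ideal &, forall a b, a + b \in rel_ideal}.
Proof.
move=> a b /asboolP aJ /asboolP bJ; apply/asboolP.
by case: (ideal_gen_ideal rels) => _ JD _; apply: JD.
Qed.

Fact rel_idealM c d a : a \in rel_ideal -> c * a * d \in rel_ideal.
Proof.
move=> /asboolP aJ; apply/asboolP.
by case: (ideal_gen_ideal rels) => _ _ JM; apply: JM.
Qed.

Fact rel_idealMl c a : a \in rel_ideal -> c * a \in rel_ideal.
Proof. by move=> /(rel_idealM c 1); rewrite mulr1. Qed.

Fact rel_idealMr c a : a \in rel_ideal -> a * c \in rel_ideal.
Proof. by move=> /(rel_idealM 1 c); rewrite mul1r. Qed.

Fact rel_ideal_zmod_closed : zmod_closed rel_ideal.
Proof.
split=> [|a b aJ bJ]; first exact: rel_ideal0.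
by rewrite -mulN1r; apply: rel_idealD => //; apply: rel_idealMl.
Qed.

HB.instance Definition _ :=
  GRing.isZmodClosed.Build _ rel_ideal rel_ideal_zmod_closed.

Definition pres_alg := Quotient.quot rel_ideal.

HB.instance Definition _ := GRing.Zmodule.on pres_alg.

Definition pres_proj (a : {malg F[{fmonom X}]}) : pres_alg := \pi_pres_alg a.
Definition pres_repr (u : pres_alg) : {malg F[{fmonom X}]} := repr u.

Fact pres_reprK : cancel pres_repr pres_proj.
Proof. exact: reprK. Qed.

Fact pres_projP a b : pres_proj a = pres_proj b <-> a - b \in rel_ideal.
Proof.
have -> : (a - b \in rel_ideal) = (pres_proj a == pres_proj b).
  exact: Quotient.idealrBE.
by split=> /eqP.
Qed.

Fact pres_projD : {morph pres_proj : a b / a + b}.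
Proof. by move=> a b; apply: (raddfD (\pi_pres_alg)). Qed.

Definition pres_one : pres_alg := pres_proj 1.
Definition pres_mul (u v : pres_alg) : pres_alg :=
  pres_proj (pres_repr u * pres_repr v).
Definition pres_scale (c : F) (u : pres_alg) : pres_alg :=
  pres_proj (c *: pres_repr u).

Fact pres_repr_proj a : pres_repr (pres_proj a) - a \in rel_ideal.
Proof. by apply/pres_projP; rewrite pres_reprK. Qed.

Fact pres_projM a b : pres_proj (a * b) = pres_mul (pres_proj a) (pres_proj b).
Proof.
apply/esym/pres_projP; set a' := pres_repr _; set b' := pres_repr _.
have -> : a' * b' - a * b = (a' - a) * b' + a * (b' - b).
  by rewrite mulrBl mulrBr addrA subrK.
apply: rel_idealD; [apply: rel_idealMr|apply: rel_idealMl];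
  exact: pres_repr_proj.
Qed.

Fact pres_projZ c a : pres_proj (c *: a) = pres_scale c (pres_proj a).
Proof.
apply/esym/pres_projP; rewrite -scalerBr -[_ - a]mul1r scalerAl.
by apply: rel_idealMl; apply: pres_repr_proj.
Qed.

Fact pres_mulA : associative pres_mul.
Proof.
move=> u v w; rewrite -[u]pres_reprK -[v]pres_reprK -[w]pres_reprK.
by rewrite -!pres_projM mulrA.
Qed.

Fact pres_mul1l : left_id pres_one pres_mul.
Proof. by move=> u; rewrite -[u]pres_reprK -pres_projM mul1r. Qed.

Fact pres_mul1r : right_id pres_one pres_mul.
Proof. by move=> u; rewrite -[u]pres_reprK -pres_projM mulr1. Qed.

Fact pres_mulDl : left_distributive pres_mul +%R.
Proof.
move=> u v w; rewrite -[u]pres_reprK -[v]pres_reprK -[w]pres_reprK.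
by rewrite -pres_projD -!pres_projM -pres_projD mulrDl.
Qed.

Fact pres_mulDr : right_distributive pres_mul +%R.
Proof.
move=> u v w; rewrite -[u]pres_reprK -[v]pres_reprK -[w]pres_reprK.
by rewrite -pres_projD -!pres_projM -pres_projD mulrDr.
Qed.

HB.instance Definition _ := GRing.Zmodule_isPzRing.Build pres_alg
  pres_mulA pres_mul1l pres_mul1r pres_mulDl pres_mulDr.

Fact pres_scaleA c d u : pres_scale c (pres_scale d u) = pres_scale (c * d) u.
Proof. by rewrite -[u]pres_reprK -!pres_projZ scalerA. Qed.

Fact pres_scale1 : left_id 1 pres_scale.
Proof. by move=> u; rewrite -[u]pres_reprK -pres_projZ scale1r. Qed.

Fact pres_scaleDr : right_distributive pres_scale +%R.
Proof.
move=> c u v; rewrite -[u]pres_reprK -[v]pres_reprK.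
by rewrite -pres_projD -!pres_projZ -pres_projD scalerDr.
Qed.

Fact pres_scaleDl u : {morph pres_scale^~ u : c d / c + d}.
Proof.
by move=> c d; rewrite -[u]pres_reprK -!pres_projZ -pres_projD scalerDl.
Qed.

HB.instance Definition _ := GRing.Zmodule_isLmodule.Build F pres_alg
  pres_scaleA pres_scale1 pres_scaleDr pres_scaleDl.

Fact pres_scaleAl c (u v : pres_alg) : c *: (u * v) = (c *: u) * v.
Proof.
rewrite -[u]pres_reprK -[v]pres_reprK /GRing.mul /GRing.scale /=.
by rewrite -pres_projM -!pres_projZ -pres_projM scalerAl.
Qed.

Fact malg_scaleAr c (a b : {malg F[{fmonom X}]}) : c *: (a * b) = a * (c *: b).
Proof.
have cC : c%:MP * a = a * c%:MP.
  rewrite !malgM_def fgmulUg fgmulgU; apply: eq_bigr => k _.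
  by rewrite mulrC mul1m mulm1.
exact: scaler_central (fun _ => esym (mul_malgC _ _)) cC.
Qed.

Fact pres_scaleAr c (u v : pres_alg) : c *: (u * v) = u * (c *: v).
Proof.
rewrite -[u]pres_reprK -[v]pres_reprK /GRing.mul /GRing.scale /=.
by rewrite -pres_projM -!pres_projZ -pres_projM malg_scaleAr.
Qed.

Definition pres_gen (x : X) : pres_alg := pres_proj (free_gen x).

End Presentation.

Section Hecke.
Variables (F : fieldType) (n : nat) (q : F).

(* Indices are shifted by one: i : 'I_n.-1 stands for the index i.+1 of the
   usual numbering of the generators from 1 to n - 1. *)
Local Notation free := {malg F[{fmonom 'I_n.-1}]}.
Local Notation G := (@free_gen F 'I_n.-1).

(* The elements (left-hand side) - (right-hand side) of the relations. *)
Definition hecke_rels : set free :=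
  [set r | exists i, r = G i ^+ 2 - ((q - 1) *: G i + q *: 1)] `|`
  [set r | exists i j : 'I_n.-1, j = i.+1 :> nat /\
             r = G i * G j * G i - G j * G i * G j] `|`
  [set r | exists i j : 'I_n.-1, (i.+2 <= j)%N /\
             r = G i * G j - G j * G i].

Definition hecke := pres_alg hecke_rels.

HB.instance Definition _ := GRing.PzRing.on hecke.
HB.instance Definition _ := GRing.Lmodule.on hecke.

(* The one-dimensional representation sending every generator to -1 shows
   that the algebra is not trivial. *)
Definition sign_fmonom (m : {fmonom 'I_n.-1}) : F := (-1) ^+ size m.

Fact sign_fmonom_mmorphism : mmorphism sign_fmonom.
Proof.
split=> [m1 m2|]; rewrite /sign_fmonom ?fm1 ?expr0 //.
by rewrite fmM size_cat exprD.
Qed.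

HB.instance Definition _ :=
  isMultiplicative.Build {fmonom 'I_n.-1} F sign_fmonom sign_fmonom_mmorphism.

Fact sign_rels (A : lalgType F) (phi : {rmorphism A -> F}) (x y : A) :
    (forall c a, phi (c *: a) = c * phi a) -> phi x = -1 -> phi y = -1 ->
  [/\ phi (x ^+ 2 - ((q - 1) *: x + q *: 1)) = 0,
      phi (x * y * x - y * x * y) = 0 & phi (x * y - y * x) = 0].
Proof.
move=> phiZ px py.
by split; rewrite ?(rmorphB, rmorphD, rmorphM, rmorphXn) ?phiZ ?rmorph1 ?px ?py; ring.
Qed.

Fact hecke_nonzero : (1 : hecke) != 0.
Proof.
have [phi [phiZ phiG]] : exists phi : {rmorphism free -> F},
    (forall c a, phi (c *: a) = c * phi a) /\ (forall i, phi (G i) = -1).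
  exists (mmap idfun sign_fmonom); split=> [c a|i] /=; first exact: mmapZ.
  by rewrite mmapU /= mul1r /sign_fmonom fmuE expr1.
apply/eqP => h10.
have : (1 : free) - 0 \in rel_ideal hecke_rels.
  by apply/pres_projP; rewrite [LHS]h10 /pres_proj raddf0.
rewrite subr0 => /asboolP /(_ [set a | phi a = 0]) phi1.
have /eqP : phi 1 = 0; last by rewrite rmorph1 oner_eq0.
apply: phi1; split; first split => [|a b /= pa pb|a b x /= px].
- exact: rmorph0.
- by rewrite rmorphD pa pb addr0.
- by rewrite !rmorphM px mulr0 mul0r.
move=> r [[[i ->]|[i [j [_ ->]]]]|[i [j [_ ->]]]].
- by case: (sign_rels phiZ (phiG i) (phiG i)) => r0 _ _; exact: r0.
- by case: (sign_rels phiZ (phiG i) (phiG j)) => _ r0 _; exact: r0.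
- by case: (sign_rels phiZ (phiG i) (phiG j)) => _ _ r0; exact: r0.
Qed.

HB.instance Definition _ :=
  GRing.PzSemiRing_isNonZero.Build hecke hecke_nonzero.
HB.instance Definition _ := GRing.Lmodule_isLalgebra.Build F hecke
  (@pres_scaleAl F 'I_n.-1 hecke_rels).
HB.instance Definition _ := GRing.Lalgebra_isAlgebra.Build F hecke
  (@pres_scaleAr F 'I_n.-1 hecke_rels).

Definition hecke_g (i : 'I_n.-1) : hecke := pres_gen hecke_rels i.

Definition hecke_f (i : 'I_n.-1) : hecke :=
  (q + 1)^-1 *: (2 *: hecke_g i - (q - 1) *: 1).

(* For n <= 2 there are no generators, so that this is the subalgebra
   generated by the unit element. *)
Definition alt_hecke_gens : set hecke :=
  [set x | exists i j : 'I_n.-1,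
             [/\ i = 0%N :> nat, (1 <= j)%N & x = hecke_f i * hecke_f j]].

Definition alt_hecke : set hecke :=
  smallest (fun B => GRing.subalg_closed (mem B)) alt_hecke_gens.

End Hecke.

Arguments hecke_rels {F} n q _.
Arguments hecke_g {F n} q i.
Arguments hecke_f {F n} q i.
Arguments alt_hecke_gens {F} n q _.
Arguments alt_hecke {F} n q _.

(* The ambient space need not be a (finite-dimensional) vectType. *)
Definition has_dim (F : fieldType) (V : lmodType F) (W : set V) (d : nat) :=
  exists e : 'I_d -> V,
    (forall a : 'I_d -> F, \sum_i a i *: e i = 0 -> forall i, a i = 0) /\
    (forall w, W w <-> exists a : 'I_d -> F, w = \sum_i a i *: e i).

(* Main.v *)
(* The f_i are involutions satisfying the commutation relations and the braid
   relation f_j f_i f_j = f_i f_j f_i + c (f_i - f_j) for |i - j| = 1, with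
   c = ((q - 1) / (q + 1))^2.  All these relations preserve the parity of the
   length of words, so that every word in the f_i reduces to a combination of
   normal forms of the same parity; there are n! normal forms, half of them of
   each parity.  The Hecke algebra acts on the functions on S_n, and the orbit of
   the delta function at the identity contains all delta functions; hence the
   normal forms span a space of dimension at least n! and are independent.  Finally
   the subalgebra generated by the f_1 f_j is the span of the even normal forms,
   because it contains f_j f_1 = (f_1 f_j)^-1, hence all words of even length. *)

Require Import Defs.
From mathcomp Require Import all_boot all_order all_fingroup all_algebra.
From mathcomp Require Import finmap.
From mathcomp Require Import boolp classical_sets reals complex.
From mathcomp Require Import ssrAC zify ring monalg.

Set Implicit Arguments.
Unset Strict Implicit.
Unset Printing Implicit Defensive.

Import GRing.Theory.
Local Open Scope ring_scope.

(** * Linear spans *)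

Section Span.
Variables (F : fieldType) (V : lmodType F).

Definition is_subspace (P : V -> Prop) :=
  P 0 /\ forall c x y, P x -> P y -> P (c *: x + y).

Lemma subspaceD P x y : is_subspace P -> P x -> P y -> P (x + y).
Proof. by move=> [_ PD] Px Py; rewrite -[x]scale1r; apply: PD. Qed.

Lemma subspaceZ P c x : is_subspace P -> P x -> P (c *: x).
Proof. by move=> [P0 PD] Px; rewrite -[_ *: _]addr0; apply: PD. Qed.

Lemma subspace_sum P (I : Type) (r : seq I) (a : I -> F) (E : I -> V) :
  is_subspace P -> (forall i, P (E i)) -> P (\sum_(i <- r) a i *: E i).
Proof.
move=> PS PE; elim: r => [|i r IHr]; first by rewrite big_nil; case: PS.
by rewrite big_cons; case: PS => _; apply.
Qed.

(** Coefficients are indexed by positions, which allows repeated entries and matches the shape of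
    [has_dim]. *)
Definition in_span (s : seq V) (x : V) :=
  exists a : 'I_(size s) -> F, x = \sum_i a i *: s`_i.

Lemma span_subspace s : is_subspace (in_span s).
Proof.
split=> [|c _ _ [a ->] [b ->]].
  by exists (fun=> 0); rewrite big1 // => i _; rewrite scale0r.
exists (fun i => c * a i + b i); rewrite scaler_sumr -big_split /=.
by apply: eq_bigr => i _; rewrite scalerDl scalerA.
Qed.

Lemma mem_in_span s x : x \in s -> in_span s x.
Proof.
move=> sx; have ltx : (index x s < size s)%N by rewrite index_mem.
exists (fun i => (i == Ordinal ltx)%:R).
rewrite (bigD1 (Ordinal ltx)) //= eqxx scale1r nth_index // big1 ?addr0 //.
by move=> i /negPf ->; rewrite scale0r.
Qed.

Lemma in_span_min s P x :
  is_subspace P -> (forall y, y \in s -> P y) -> in_span s x -> P x.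
Proof.
move=> PS sP [a ->]; apply: subspace_sum => // i; exact/sP/mem_nth.
Qed.

Lemma sub_in_span s t x : {subset s <= t} -> in_span s x -> in_span t x.
Proof.
move=> sub; apply: in_span_min => [|y /sub]; first exact: span_subspace.
exact: mem_in_span.
Qed.

End Span.

Lemma linear0_of (F : fieldType) (U W : lmodType F) (h : U -> W) :
  linear h -> h 0 = 0.
Proof.
by move=> hL; have := hL (-1) 0 0; rewrite scaler0 addr0 scaleN1r addNr.
Qed.

Lemma subspace_preim (F : fieldType) (V W : lmodType F) (h : V -> W) P :
  linear h -> is_subspace P -> is_subspace (fun x => P (h x)).
Proof.
move=> hlin PS; split=> [|c x y Px Py]; last by rewrite hlin; case: PS => _; apply.
by rewrite linear0_of //; case: PS.
Qed.

Lemma subspace_mull (F : fieldType) (A : algType F) (u : A) P :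
  is_subspace P -> is_subspace (fun x => P (u * x)).
Proof.
by apply: subspace_preim => c x y; rewrite mulrDr -scalerAr.
Qed.

(** * Normal forms in the involutions *)

Section NormalForms.
Variables (F : fieldType) (A : algType F) (f : nat -> A) (c : F) (N : nat).

(* The product f_(k-l+1) ... f_(k-1) f_k of l factors. *)
Fixpoint run (k l : nat) : A :=
  if l is l'.+1 then f (k - l') * run k l' else 1.

(* The words r_(k-1) ... r_1 r_0, where r_m is one of the m + 2 runs ending at
   f_m, whose total length has parity b. *)
Fixpoint normal_forms (k : nat) (b : bool) : seq A :=
  if k is k'.+1 then
    flatten [seq [seq run k' l * x | x <- normal_forms k' (b (+) odd l)]
            | l <- iota 0 k'.+2]
  else if b then [::] else [:: 1].

Arguments normal_forms : simpl never.

Lemma normal_formsS k b : normal_forms k.+1 b =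
  flatten [seq [seq run k l * x | x <- normal_forms k (b (+) odd l)]
          | l <- iota 0 k.+2].
Proof. by []. Qed.

(** The parities balance only from level 1 on, the empty word being the sole normal form at level 0;
    hence [k.+1]. In the induction step each of the k + 3 run lengths contributes the same number of
    words, whatever parity it selects. *)
Lemma size_normal_forms k b : (size (normal_forms k.+1 b)).*2 = k.+2`!.
Proof.
elim: k b => [|k IHk] b; first by case: b.
have szE k' b' : size (normal_forms k'.+1 b') =
    (\sum_(0 <= l < k'.+2) size (normal_forms k' (b' (+) odd l)))%N.
  rewrite normal_formsS size_flatten /shape -map_comp sumnE big_map.
  by rewrite /index_iota subn0; apply: eq_bigr => l _; rewrite /= size_map.
rewrite szE -muln2 big_distrl /=.
under eq_bigr => l _ do rewrite muln2 IHk.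
by rewrite sum_nat_const_nat subn0 factS.
Qed.

Lemma mem_normal_forms k l b x :
  (l <= k.+1)%N -> x \in normal_forms k b ->
  run k l * x \in normal_forms k.+1 (b (+) odd l).
Proof.
move=> lek xN; rewrite normal_formsS; apply/flattenP.
exists [seq run k l * y | y <- normal_forms k (b (+) odd l (+) odd l)].
  apply: (@map_f _ _ (fun l' => [seq run k l' * y
    | y <- normal_forms k (b (+) odd l (+) odd l')]) (iota 0 k.+2)).
  by rewrite mem_iota.
by apply: map_f; rewrite -addbA addbb addbF.
Qed.

Lemma normal_formsP k b y : y \in normal_forms k.+1 b ->
  exists l x, [/\ (l <= k.+1)%N, x \in normal_forms k (b (+) odd l) &
                  y = run k l * x].
Proof.
rewrite normal_formsS => /flattenP[s /mapP[l]]; rewrite mem_iota => lek -> /mapP[x xN ->].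
by exists l, x.
Qed.

Lemma run_cat k a b : run k (a + b) = run (k - a) b * run k a.
Proof.
elim: b => [|b IHb]; first by rewrite addn0 mul1r.
by rewrite addnS /= IHb mulrA subnDA.
Qed.

Lemma run_rcons k l : run k.+1 l.+1 = run k l * f k.+1.
Proof. by rewrite -[l.+1]add1n run_cat subn1 /= subn0 mulr1. Qed.

Lemma comm_run x k l :
  (forall m, (m < l)%N -> GRing.comm x (f (k - m))) -> GRing.comm x (run k l).
Proof.
elim: l => [|l IHl] comm; first exact: commr1.
apply: commrM; first exact: comm.
by apply: IHl => m ltml; apply: comm; apply: leqW.
Qed.

Notation span k b := (in_span (normal_forms k b)).

Lemma span1 k : span k false 1.
Proof.
apply: mem_in_span; elim: k => [|k IHk]; first exact: mem_head.
by rewrite -[1]mulr1; apply: (@mem_normal_forms k 0 false).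
Qed.

Lemma span_run k l b x : (l <= k.+1)%N -> span k b x ->
  span k.+1 (b (+) odd l) (run k l * x).
Proof.
move=> lek; apply: (@in_span_min _ _ _ (fun x => span _ _ (run k l * x))).
  exact/subspace_mull/span_subspace.
by move=> y yN; apply: mem_in_span; apply: mem_normal_forms.
Qed.

Hypothesis f_sq : forall i, (i < N)%N -> f i * f i = 1.
Hypothesis f_braid : forall i, (i.+1 < N)%N ->
  f i.+1 * f i * f i.+1 = f i * f i.+1 * f i + c *: (f i - f i.+1).
Hypothesis f_comm : forall i j, (i.+1 < j)%N -> (j < N)%N ->
  f i * f j = f j * f i.

Lemma f_run_lt i k l : (i + l < k)%N -> (k < N)%N -> f i * run k l = run k l * f i.
Proof.
move=> lti ltk; apply: comm_run => m ltm; apply: f_comm; last lia.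
by lia.
Qed.

(** At [m = 0] the bound forces [b = 0], so the default [0.-1 = 0] only meets an empty run. *)
Lemma run_rcons_pred m b : (b <= m)%N -> run m b.+1 = run m.-1 b * f m.
Proof.
case: m => [|m] lebm; last exact: run_rcons.
by move: lebm; rewrite leqn0 => /eqP ->; rewrite /= mulr1 mul1r.
Qed.

(** The first bound keeps the indices of the two runs at least two apart. *)
Lemma comm_run_run a b k m : (m + a.+1 <= k)%N -> (b <= m.+1)%N -> (k < N)%N ->
  run k a * run m b = run m b * run k a.
Proof.
move=> le_k le_b lt_k; apply/comm_run => i lti; apply/esym/comm_run => j ltj.
by apply: f_comm; lia.
Qed.

(* Unlike for the g_i, moving f_(m+1) through a run creates two correction terms;
   they have the same parity as the main one. *)
Lemma f_run_mid a b m k : (k - a = m.+1)%N -> (b <= m)%N -> (k < N)%N ->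
  f m.+1 * run k (a + b.+2) =
  run k (a + b.+2) * f m +
  c *: (run k a * run m b.+1 - run k a.+1 * run m.-1 b).
Proof.
move=> kaE le_b lt_k; have lt_m : (m.+1 < N)%N by lia.
(* The pair [f m * f m.+1] separates indices below [m] from indices above [m.+1]. A further [f m.+1]
   passes the left part and completes the left side of the braid relation. *)
have runE : run k (a + b.+2) = run m.-1 b * (f m * f m.+1) * run k a.
  by rewrite run_cat kaE run_rcons run_rcons_pred // !mulrA.
have f_am : run k a * f m = f m * run k a.
  by apply/esym/comm_run => i lti; apply: f_comm; lia.
have f_b : f m.+1 * run m.-1 b = run m.-1 b * f m.+1.
  by apply: comm_run => i lti; apply/esym/f_comm; lia.
have -> : run k a * run m b.+1 = run m.-1 b * f m * run k a.
  by rewrite -run_rcons_pred //; apply: comm_run_run; lia.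
have -> : run k a.+1 * run m.-1 b = run m.-1 b * f m.+1 * run k a.
  rewrite [run k a.+1]/= kaE -mulrA -f_b -!mulrA; congr (_ * _).
  (* For [m = 0] the truncated predecessor destroys the gap between the runs, but then the second
     run is empty. *)
  case: (posnP m) => [m0|m_gt0]; last by apply: comm_run_run; lia.
  have -> : b = 0%N by lia.
  by rewrite [run _ 0]/= mulr1 mul1r.
rewrite runE !mulrA f_b -(mulrA _ (run k a)) f_am.
have -> : run m.-1 b * f m.+1 * f m * f m.+1 * run k a =
          run m.-1 b * (f m.+1 * f m * f m.+1) * run k a by rewrite !mulrA.
rewrite f_braid // mulrDr mulrDl -scalerAr -scalerAl !mulrA.
by rewrite mulrBr mulrBl.
Qed.

Section SpanStep.
Variable k : nat.
Hypothesis IHk : forall b x i, (i < k)%N -> span k b x -> span k (~~ b) (f i * x).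

(** Applies the induction hypothesis letter by letter; this absorbs the inner runs in the correction
    terms of [f_run_mid]. *)
Lemma span_run_lt m l b x : (m < k)%N -> (l <= m.+1)%N -> span k b x ->
  span k (b (+) odd l) (run m l * x).
Proof.
move=> ltm; elim: l => [|l IHl] lel xS; first by rewrite mul1r addbF.
by rewrite /= -mulrA addbN; apply: IHk; [lia | apply: IHl => //; lia].
Qed.

(** Four positions of [i] relative to the first index of the run: two or more below, [f i] commutes
    with the run; just below, it lengthens it; equal, it cancels by [f_sq]; above, [f_run_mid]
    applies. *)
Lemma span_f_run l b x i : (k < N)%N -> (l <= k.+1)%N -> (i < k.+1)%N ->
  span k b x -> span k.+1 (~~ (b (+) odd l)) (f i * (run k l * x)).
Proof.
move=> ltk lel lti xS.
have [lt_i | ] := ltnP (i + l) k.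
  rewrite mulrA f_run_lt // -mulrA -addNb.
  by apply: span_run => //; apply: IHk => //; lia.
rewrite leq_eqVlt => /predU1P[kE | gt_i].
  have -> : i = (k - l)%N by lia.
  by rewrite mulrA -addbN; apply: (@span_run k l.+1) => //; lia.
case: l => [|l] in lel gt_i *; first lia.
have [->|neq_i] := eqVneq i (k - l)%N.
  by rewrite /= !mulrA f_sq ?mul1r ?addbN ?negbK; [apply: span_run => //; lia | lia].
have [m iE] : exists m, i = m.+1 by exists i.-1; lia.
(* [a] counts the factors of the run to the right of [f i], and [d] those to the left of [f m]. *)
pose a := (k - i)%N; pose d := (l.+1 - a - 2)%N.
have lE : l.+1 = (a + d.+2)%N by rewrite /d /a; lia.
rewrite mulrA iE lE f_run_mid //; [| by rewrite /a; lia | by rewrite /d /a; lia].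
rewrite mulrDl -scalerAl mulrBl -lE -!(mulrA (run _ _)).
have PS := span_subspace (normal_forms k.+1 (~~ (b (+) odd l.+1))).
apply: (subspaceD PS); last apply: (subspaceZ _ PS).
  by rewrite -addNb; apply: span_run => //; apply: IHk => //; lia.
rewrite -[- _]scaleN1r addrC; case: (PS) => _; apply.
- have -> : ~~ (b (+) odd l.+1) = b (+) odd d (+) odd a.+1.
    by rewrite lE /= oddD /= negbK; case: (b) (odd a) (odd d) => -[] [].
  by apply: span_run; [rewrite /a; lia | apply: span_run_lt => //; rewrite /d /a; lia].
have -> : ~~ (b (+) odd l.+1) = b (+) odd d.+1 (+) odd a.
  by rewrite lE /= oddD /= negbK; case: (b) (odd a) (odd d) => -[] [].
by apply: span_run; [rewrite /a; lia | apply: span_run_lt => //; rewrite /d /a; lia].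
Qed.

End SpanStep.

(** Induction on the level: [span_f_run] treats the leading run, and any letter that passes it acts
    on a normal form of lower level. *)
Lemma span_f k b x i : (k <= N)%N -> (i < k)%N -> span k b x ->
  span k (~~ b) (f i * x).
Proof.
elim: k b x i => [//|k IHk] b x i lek lti.
apply: (@in_span_min _ _ _ (fun x => span _ _ (f i * x))) => [|y].
  exact/subspace_mull/span_subspace.
move=> /normal_formsP[l [z [lel zN ->]]].
rewrite -[b in ~~ b](addbK (odd l)); apply: span_f_run => //.
  by move=> b' x' i' lti'; apply: IHk => //; apply: ltnW.
exact: mem_in_span.
Qed.

End NormalForms.

(** * The Hecke relations *)

Section Involution.
Variables (F : fieldType) (A : algType F) (q : F).
Implicit Types u v s t : A.

Definition involution u : A := (q + 1)^-1 *: (2 *: u - (q - 1) *: 1).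

Hypothesis q1 : q + 1 != 0.

Lemma sqr_lin (p r a b : F) u : u * u = p *: u + r *: 1 ->
  (a *: u + b *: 1) * (a *: u + b *: 1) =
  (a * a * p + a * b + b * a) *: u + (a * a * r + b * b) *: 1.
Proof.
move=> u2; rewrite mulrDl !mulrDr -!scalerAl -!scalerAr !mul1r !mulr1 u2.
rewrite scalerDr !scalerDr !scalerA !scalerDl !addrA.
by rewrite [LHS](ACl (1*3*4*2*5)).
Qed.

(** The quadratic relation has roots q and -1, which the affine map [involution] sends to 1 and
    -1. *)
Lemma involution_sq u : u * u = (q - 1) *: u + q *: 1 ->
  involution u * involution u = 1.
Proof.
move=> u2.
have -> : involution u =
    (2 / (q + 1)) *: u + ((1 - q) / (q + 1)) *: 1.
  rewrite /involution scalerBr -scalerN -scaleNr !scalerA ![_^-1 * _]mulrC.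
  by rewrite opprB.
rewrite (sqr_lin _ _ u2); set a := (X in X *: u); set b := (X in _ + X *: _).
have -> : a = 0 by rewrite /a; field.
have -> : b = 1 by rewrite /b; field.
by rewrite scale0r add0r scale1r.
Qed.

Lemma comm_involution x u : GRing.comm x u -> GRing.comm x (involution u).
Proof.
rewrite /GRing.comm /involution -scalerAr -scalerAl mulrBr mulrBl.
by rewrite -!scalerAr -!scalerAl mulr1 mul1r => ->.
Qed.

Lemma involution_comm u v : GRing.comm u v ->
  GRing.comm (involution u) (involution v).
Proof. by move=> uv; apply/comm_involution/commr_sym/comm_involution/commr_sym. Qed.

(** The last group is symmetric in [s] and [t], so it cancels when two such products are
    compared. *)
Lemma braid_expand (y : F) s t : s * s = 1 ->
  (s + y *: 1) * (t + y *: 1) * (s + y *: 1) =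
  s * t * s + (y * y) *: s +
  (y *: (s * t + t * s) + (y * y) *: (s + t) + (y + y * y * y) *: 1).
Proof.
move=> s2.
have -> : (s + y *: 1) * (t + y *: 1) = s * t + y *: s + y *: t + (y * y) *: 1.
  by rewrite mulrDl !mulrDr -!scalerAl -!scalerAr !mul1r !mulr1 scalerA !addrA.
rewrite mulrDr !mulrDl -!scalerAl -!scalerAr mul1r mulr1 s2.
rewrite !(scalerDr, scalerDl) !scalerA !addrA !mulr1.
by rewrite [LHS](ACl (1*4*5*3*6*7*2*8)).
Qed.

Let y := (q - 1) / (q + 1).

Lemma involutionK u : involution u + y *: 1 = (2 / (q + 1)) *: u.
Proof. by rewrite /involution scalerBr !scalerA ![_^-1 * _]mulrC subrK. Qed.

(** Adding [y] to an involution gives a multiple of the generator, so the shifted involutions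
    satisfy the plain braid relation. Expanding it and cancelling the symmetric part leaves the
    terms in [y * y]. *)
Lemma involution_braid u v :
    u * u = (q - 1) *: u + q *: 1 -> v * v = (q - 1) *: v + q *: 1 ->
    u * v * u = v * u * v ->
  involution v * involution u * involution v =
  involution u * involution v * involution u +
  (y * y) *: (involution u - involution v).
Proof.
move=> /involution_sq u2 /involution_sq v2 uvu.
have : (involution u + y *: 1) * (involution v + y *: 1) * (involution u + y *: 1)
     = (involution v + y *: 1) * (involution u + y *: 1) * (involution v + y *: 1).
  by rewrite !involutionK -!scalerAl -!scalerAr -!scalerAl uvu.
rewrite !braid_expand // [_ * involution u + involution u * _]addrC.
rewrite [involution u + _]addrC => /addIr E.
by rewrite scalerBr addrA E addrK.
Qed.

End Involution.

Section Relations.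
Variables (F : fieldType) (n : nat) (q : F).
Notation g := (@hecke_g F n q).

Lemma pres_proj_rel (X : choiceType) (rels : set {malg F[{fmonom X}]}) a b :
  rels (a - b) -> pres_proj rels a = pres_proj rels b.
Proof. by move=> rab; apply/pres_projP/asboolP => J [_]; apply. Qed.

Notation G := (@free_gen F 'I_n.-1).
Notation proj := (@pres_proj F 'I_n.-1 (hecke_rels n q)).

Lemma hecke_g_sq i : g i * g i = (q - 1) *: g i + q *: 1.
Proof.
have projZ c a : c *: (proj a : hecke n q) = proj (c *: a).
  exact/esym/pres_projZ.
have -> : g i * g i = proj (G i * G i) by exact/esym/pres_projM.
have -> : (1 : hecke n q) = proj 1 by [].
rewrite (projZ (q - 1) (G i)) (projZ q 1).
apply: etrans (pres_projD _ _ _).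
by apply: pres_proj_rel; left; left; exists i; rewrite expr2.
Qed.

Lemma proj_mul3 i j k : g i * g j * g k = proj (G i * G j * G k).
Proof.
have -> : g i * g j = proj (G i * G j) by exact/esym/pres_projM.
exact/esym/pres_projM.
Qed.

Lemma hecke_g_braid (i j : 'I_n.-1) : j = i.+1 :> nat ->
  g i * g j * g i = g j * g i * g j.
Proof.
move=> ji; apply: (etrans (proj_mul3 i j i)).
apply: etrans (esym (proj_mul3 j i j)).
by apply: pres_proj_rel; left; right; exists i, j.
Qed.

Lemma hecke_g_comm (i j : 'I_n.-1) : (i.+1 < j)%N -> g i * g j = g j * g i.
Proof.
move=> ij; apply: (etrans (esym (pres_projM _ (G i) (G j)))).
apply: etrans (pres_projM _ (G j) (G i)).
by apply: pres_proj_rel; right; exists i, j.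
Qed.

End Relations.

(** * The even subalgebra *)

Lemma subalg_closedP (F : fieldType) (A : algType F) (B : set A) :
  GRing.subalg_closed (mem B) <->
  [/\ B 1, is_subspace B & forall x y, B x -> B y -> B (x * y)].
Proof.
have memE x : (x \in mem B) <-> B x by rewrite inE.
split=> [[B1 BL BM]|[B1 [B0 BL] BM]].
  split; [exact/memE | split | ].
  (* Zero is obtained as (-1) * 1 + 1. *)
  - by have := BL (-1) 1 1 B1 B1; rewrite scaleN1r addNr => /memE.
  - by move=> c x y Bx By; apply/memE/BL; apply/memE.
  - by move=> x y Bx By; apply/memE/BM; apply/memE.
split; first exact/memE.
- by move=> c x y /memE Bx /memE By; apply/memE/BL.
- by move=> x y /memE Bx /memE By; apply/memE/BM.
Qed.

Section EvenPart.
Variables (F : fieldType) (A : algType F) (f : nat -> A) (c : F) (N : nat).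

Hypothesis f_sq : forall i, (i < N)%N -> f i * f i = 1.
Hypothesis f_braid : forall i, (i.+1 < N)%N ->
  f i.+1 * f i * f i.+1 = f i * f i.+1 * f i + c *: (f i - f i.+1).
Hypothesis f_comm : forall i j, (i.+1 < j)%N -> (j < N)%N ->
  f i * f j = f j * f i.

Variable gens : set A.
Hypothesis gensP : forall x, gens x <->
  exists j, [/\ (0 < j)%N, (j < N)%N & x = f 0%N * f j].

Notation alt := (smallest (fun B => GRing.subalg_closed (mem B)) gens).
Notation span k b := (in_span (normal_forms f k b)).

Lemma alt_closed : GRing.subalg_closed (mem alt).
Proof.
apply/subalg_closedP; split=> [B [/subalg_closedP[]//]||x y Bx By B [BC BG]].
  split=> [B [/subalg_closedP[_ []]//]|a x y Bx By B [BC BG]].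
  by case/subalg_closedP: (BC) => _ [_ BL] _; apply: BL; [apply: Bx | apply: By].
by case/subalg_closedP: (BC) => _ _ BM; apply: BM; [apply: Bx | apply: By].
Qed.

(** The elements whose left multiplication preserves the spans of both parities form a subalgebra
    containing the generators; applying such an element to 1 lands in the even span. *)
Lemma alt_in_span x : alt x -> span N false x.
Proof.
pose B := [set x | forall b y, span N b y -> span N b (x * y)]%classic.
move=> /(_ B) Bx; rewrite -[x]mulr1; apply: Bx; last exact: span1.
split.
  apply/subalg_closedP; split.
  - by move=> b y ySp; rewrite mul1r.
  - have PS b := span_subspace (normal_forms f N b).
    split=> [b y _|a u v Bu Bv b y ySp]; first by rewrite mul0r; case: (PS b).
    by rewrite mulrDl -scalerAl; case: (PS b) => _; apply; [apply: Bu | apply: Bv].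
  - by move=> u v Bu Bv b y ySp; rewrite -mulrA; apply/Bu/Bv.
move=> _ /gensP[j [j0 jN ->]] b y ySp; rewrite -mulrA -[b]negbK.
apply: (span_f f_sq f_braid f_comm) => //; first lia.
exact: (span_f f_sq f_braid f_comm).
Qed.

(* Only [j = 1] is not immediate: there, for [x = f 0 * f 1], the braid relation
   multiplied by [f 1] gives [f 1 * f 0 = x^-1 = x * x + c x - c]. *)
Lemma alt_f_f0 j : (j < N)%N -> alt (f j * f 0%N).
Proof.
move=> ltj; have /subalg_closedP[alt1 [alt0 altL] altM] := alt_closed.
have altG i : (0 < i)%N -> (i < N)%N -> alt (f 0%N * f i).
  by move=> i0 iN B [_]; apply; apply/gensP; exists i.
have lt0 : (0 < N)%N by lia.
case: j ltj => [|[|j]] ltj.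
- by rewrite f_sq.
- have := altG 1%N isT ltj; set x := f 0%N * f 1%N => altx.
  have -> : f 1%N * f 0%N = x * x + c *: x + (- c) *: 1.
    have := congr1 (fun u => u * f 1%N) (f_braid ltj).
    rewrite mulrDl -scalerAl mulrBl -!mulrA f_sq // mulr1 => ->.
    by rewrite scalerBr scaleNr !mulrA addrA.
  rewrite -addrA -[x * x]scale1r; apply: (altL _ _ _ (altM _ _ altx altx)).
  exact: (altL _ _ _ altx (subspaceZ _ (conj alt0 altL) alt1)).
- by rewrite -f_comm //; apply: altG.
Qed.

(** Odd words are normalized by a leading [f 0]. With this convention a new letter contributes a
    factor [f i * f 0] or [f 0 * f i], and both lie in the subalgebra. *)
Lemma alt_f_mul (b : bool) i x : (i < N)%N ->
  alt (if b then f 0%N * x else x) ->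
  alt (if ~~ b then f 0%N * (f i * x) else f i * x).
Proof.
move=> lti; have /subalg_closedP[alt1 _ altM] := alt_closed.
case: b => /= altx.
  have -> : f i * x = f i * f 0%N * (f 0%N * x).
    by rewrite -!mulrA [f 0%N * (f 0%N * x)]mulrA f_sq ?mul1r //; lia.
  by apply: altM => //; apply: alt_f_f0.
rewrite mulrA; apply: altM => //; case: i lti => [|i] lti; first by rewrite f_sq.
by move=> B [_]; apply; apply/gensP; exists i.+1.
Qed.

Lemma alt_normal_forms k b x : (k <= N)%N -> x \in normal_forms f k b ->
  alt (if b then f 0%N * x else x).
Proof.
elim: k b x => [|k IHk] b x lek.
  case: b => //; rewrite inE => /eqP ->.
  by have /subalg_closedP[] := alt_closed.
move=> /normal_formsP[l [y [lel yN ->]]].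
rewrite -[b](addbK (odd l)); move: (b (+) odd l) yN => b' yN {b x}.
elim: l lel => [|l IHl] lel; first by rewrite addbF mul1r; apply: IHk => //; lia.
rewrite /= -mulrA addbN; apply: alt_f_mul; first lia.
by apply: IHl; lia.
Qed.

Lemma altE x : alt x <-> span N false x.
Proof.
split; first exact: alt_in_span.
apply: (@in_span_min _ _ _ alt) => [|y yN].
  by have /subalg_closedP[] := alt_closed.
exact: (@alt_normal_forms N false).
Qed.

End EvenPart.

(** * Modules over a presented algebra *)

Lemma linear_combination (F : fieldType) (U W : lmodType F) (h : U -> W) : linear h ->
  forall (I : Type) (r : seq I) (a : I -> F) (E : I -> U),
  h (\sum_(i <- r) a i *: E i) = \sum_(i <- r) a i *: h (E i).
Proof.
move=> hL I r a E; elim: r => [|i r IHr]; last by rewrite !big_cons hL IHr.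
by rewrite !big_nil linear0_of.
Qed.

Section Modules.
Variables (F : fieldType) (X : choiceType) (V : lmodType F) (T : X -> V -> V).
Hypothesis T_linear : forall x, linear (T x).
Notation free := {malg F[{fmonom X}]}.

Definition word_act (m : {fmonom X}) (v : V) : V := foldr T v m.

Definition malg_act (a : free) (v : V) : V :=
  \sum_(m <- msupp a) a@_m *: word_act m v.

(** Enlarging the support lets several elements be summed over a common set of words, so that
    linearity is checked termwise. *)
Lemma malg_actEw (d : {fset {fmonom X}}) a v : (msupp a `<=` d)%fset ->
  malg_act a v = \sum_(m <- d) a@_m *: word_act m v.
Proof.
move=> le; rewrite /malg_act (big_fset_incl _ le) //= => m _ mNa.
by rewrite mcoeff_outdom // scale0r.
Qed.

Lemma malg_act_linear v : linear (malg_act^~ v).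
Proof.
move=> c a b; pose d := (msupp a `|` msupp b)%fset.
rewrite (@malg_actEw d (_ + _)) ?(@malg_actEw d a) ?(@malg_actEw d b)
  ?fsubsetUl ?fsubsetUr //.
  rewrite scaler_sumr -big_split /=; apply: eq_bigr => m _.
  by rewrite mcoeffD mcoeffZ scalerDl scalerA.
apply: fsubset_trans (msuppD_le _ _) _.
by apply: fsetSU; apply: msuppZ_le.
Qed.

Lemma malg_actZ c a v : malg_act (c *: a) v = c *: malg_act a v.
Proof.
have := malg_act_linear v c a 0.
by rewrite !addr0 => ->; rewrite (linear0_of (malg_act_linear v)) addr0.
Qed.

Lemma malg_actB a b v : malg_act (a - b) v = malg_act a v - malg_act b v.
Proof.
rewrite addrC [RHS]addrC -!scaleN1r; exact: malg_act_linear.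
Qed.

Lemma malg_actU c m v : malg_act << c *g m >> v = c *: word_act m v.
Proof. by rewrite (malg_actEw _ msuppU_le) big_seq_fset1 mcoeffUU. Qed.

Lemma malg_act_gen x v : malg_act (free_gen F x) v = T x v.
Proof. by rewrite malg_actU scale1r /word_act fmuE. Qed.

Lemma malg_act1 v : malg_act 1 v = v.
Proof. by rewrite malg_actU scale1r /word_act fm1. Qed.

Lemma word_act_linear m : linear (word_act m).
Proof.
rewrite /word_act; elim: (m : seq X) => [|x s IHs] c u v //=.
by rewrite IHs T_linear.
Qed.

Lemma malg_actM a b v : malg_act (a * b) v = malg_act a (malg_act b v).
Proof.
rewrite malgME.
have UE c (m : {fmonom X}) : << c *g m >> = c *: (<< m >> : free).
  by apply/malgP => k; rewrite (mcoeffZ c) !mcoeffU;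
     case: eqP => _; rewrite ?mulr1 ?mulr0.
under eq_bigr => m1 _.
  under eq_bigr => m2 _ do rewrite UE -scalerA.
  rewrite -scaler_sumr; over.
rewrite (linear_combination (malg_act_linear v)); apply: eq_bigr => m1 _; congr (_ *: _).
rewrite (linear_combination (malg_act_linear v)).
rewrite (linear_combination (word_act_linear m1)).
apply: eq_bigr => m2 _; congr (_ *: _).
by rewrite malg_actU scale1r /word_act fmM foldr_cat.
Qed.

Lemma malg_act_gen2 x1 x2 v :
  malg_act (free_gen F x1 * free_gen F x2) v = T x1 (T x2 v).
Proof. by rewrite malg_actM !malg_act_gen. Qed.

Lemma malg_act_gen3 x1 x2 x3 v :
  malg_act (free_gen F x1 * free_gen F x2 * free_gen F x3) v =
  T x1 (T x2 (T x3 v)).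
Proof. by rewrite malg_actM malg_act_gen2 malg_act_gen. Qed.

(** The action descends to the quotient, and [Phi] is the orbit map sending an element to its action
    on [v0]. *)
Lemma pres_module (rels : set free) (v0 : V) :
    (forall r v, rels r -> malg_act r v = 0) ->
  exists Phi : pres_alg rels -> V,
    [/\ linear Phi, Phi 1 = v0 &
        forall x u, Phi (pres_gen rels x * u) = T x (Phi u)].
Proof.
move=> rels0.
have ideal0 a v : ideal_gen rels a -> malg_act a v = 0.
  (* The annihilator of all of [V], rather than of a single vector, is a two-sided ideal. *)
  move=> /(_ [set a | forall v, malg_act a v = 0]%classic); apply; split; last first.
    by move=> r rr u; apply: rels0.
  split=> [u|a1 a2 a10 a20 u|a1 a2 a3 a30 u]; first exact: linear0_of (malg_act_linear u).
    by rewrite -[a1]scale1r malg_act_linear a10 a20 scaler0 addr0.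
  by rewrite !malg_actM a30 -(linear0_of (malg_act_linear u)) -malg_actM mulr0.
have actE a v : malg_act (pres_repr (pres_proj rels a)) v = malg_act a v.
  have /asboolP aJ := pres_repr_proj rels a; have := ideal0 _ v aJ.
  by rewrite malg_actB => /eqP; rewrite subr_eq0 => /eqP.
exists (fun u => malg_act (pres_repr u) v0); split.
- move=> c u w; rewrite -[u]pres_reprK -[w]pres_reprK.
  rewrite !pres_reprK -malg_act_linear.
  apply: etrans (actE _ _); congr (malg_act (pres_repr _) v0).
  by apply/esym; apply: (etrans (pres_projD _ _ _)); rewrite pres_reprK; congr (_ + _).
- exact: (etrans (actE 1 v0) (malg_act1 v0)).
- move=> x u; rewrite -malg_act_gen -malg_actM.
  have mulE : pres_gen rels x * u = pres_proj rels (free_gen F x * pres_repr u).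
    exact: esym (etrans (pres_projM _ _ _) (congr1 (pres_mul _) (pres_reprK u))).
  apply: etrans (actE _ _).
  exact: (congr1 (fun w : pres_alg rels => malg_act (pres_repr w) v0) mulE).
Qed.

End Modules.

(** * The regular representation *)

Section PermutationModule.
Variables (F : fieldType) (q : F) (N : nat).
Local Notation perms := {perm 'I_N.+1}.
Local Notation V := {ffun perms -> F^o}.

Definition swap i : perms := tperm (inord i) (inord i.+1).

(* On the basis of the delta functions e_w, a generator maps e_w to e_(w s_i) if
   w has an ascent at i and to q e_(w s_i) + (q - 1) e_w otherwise; the formula
   below gives the coefficient of e_w in the image of v.  The product of
   permutations is in diagrammatic order, so that [swap i * w] is w s_i. *)
Definition hecke_act i (v : V) : V :=
  [ffun w : perms => if (w (inord i) < w (inord i.+1))%N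
    then q * v (swap i * w)%g else v (swap i * w)%g + (q - 1) * v w].

Lemma swapL i : swap i (inord i) = inord i.+1. Proof. exact: tpermL. Qed.

Lemma swapR i : swap i (inord i.+1) = inord i. Proof. exact: tpermR. Qed.

Lemma inord_neq i j : (i < N.+1)%N -> (j < N.+1)%N -> i != j ->
  inord i != inord j :> 'I_N.+1.
Proof.
by move=> lti ltj; apply: contra => /eqP/(congr1 val); rewrite /= !inordK // => ->.
Qed.

Lemma swapD i j : (i < N)%N -> (j < N.+1)%N -> i != j -> i.+1 != j ->
  swap i (inord j) = inord j.
Proof. by move=> lti ltj ij ij1; rewrite /swap tpermD //; apply: inord_neq => //; lia. Qed.

Lemma swapK i w : (swap i * (swap i * w) = w)%g.
Proof. by rewrite mulgA tperm2 mul1g. Qed.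

Lemma hecke_act_linear i : linear (hecke_act i).
Proof.
move=> c u v; apply/ffunP => w; rewrite !ffunE /GRing.scale /=.
by case: ifP => _; ring.
Qed.

(** Exactly one of [w] and [swap i * w] has an ascent at [i], which leaves one polynomial identity
    per case. *)
Lemma hecke_act_sq i v : (i < N)%N ->
  hecke_act i (hecke_act i v) = (q - 1) *: hecke_act i v + q *: v.
Proof.
move=> lti; apply/ffunP => w; rewrite !ffunE /GRing.scale /= swapK !permM.
rewrite swapL swapR; have : w (inord i) <> w (inord i.+1) :> nat.
  by move=> /val_inj/perm_inj/eqP; apply/negP/inord_neq; lia.
by case: ltngtP => // _ _; ring.
Qed.

Lemma swap_comm i j : (i.+1 < j)%N -> (j < N)%N -> (swap i * swap j = swap j * swap i)%g.
Proof.
move=> lti ltj; rewrite conjgC; congr (_ * _)%g.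
by rewrite /swap tpermJ -/(swap j) !swapD //; lia.
Qed.

(** Both sides reduce to a conjugate of one swap by the other, namely the transposition of [i] and
    [i.+2]. *)
Lemma swap_braid i : (i.+1 < N)%N ->
  (swap i * (swap i.+1 * swap i) = swap i.+1 * (swap i * swap i.+1))%g.
Proof.
move=> lti; rewrite [(swap i * swap _)%g]conjgC [(swap _ * swap i)%g]conjgC.
rewrite !swapK {1 3}/swap !tpermJ.
by rewrite swapL (swapD (i := i) (j := i.+2)) ?(swapD (i := i.+1) (j := i)) ?swapR //; lia.
Qed.

Lemma hecke_act_comm i j v : (i.+1 < j)%N -> (j < N)%N ->
  hecke_act i (hecke_act j v) = hecke_act j (hecke_act i v).
Proof.
move=> lti ltj; apply/ffunP => w; rewrite !ffunE !permM.
rewrite !swapD; try lia.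
have -> : (swap i * (swap j * w) = swap j * (swap i * w))%g.
  by rewrite !mulgA swap_comm.
by case: ifP => _; case: ifP => _; ring.
Qed.

Lemma hecke_act_braid i v : (i.+1 < N)%N ->
  hecke_act i (hecke_act i.+1 (hecke_act i v)) =
  hecke_act i.+1 (hecke_act i (hecke_act i.+1 v)).
Proof.
move=> lti; apply/ffunP => w.
have braid : (swap i * (swap i.+1 * (swap i * w)) =
              swap i.+1 * (swap i * (swap i.+1 * w)))%g.
  by rewrite !mulgA -!(mulgA (swap _) (swap _) (swap _)) swap_braid // !mulgA.
have s2p0 : swap i.+1 (inord i) = inord i by rewrite swapD //; lia.
have s1p2 : swap i (inord i.+2) = inord i.+2 by rewrite swapD //; lia.
rewrite !ffunE !permM !(swapL, swapR, s2p0, s1p2) !swapK braid.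
have w_neq j k : (j < N.+1)%N -> (k < N.+1)%N -> j != k ->
    w (inord j) <> w (inord k) :> nat.
  by move=> ltj ltk jk /val_inj/perm_inj/eqP; apply/negP/inord_neq.
have [w01 w02 w12] : [/\ w (inord i) <> w (inord i.+1) :> nat,
    w (inord i) <> w (inord i.+2) :> nat & w (inord i.+1) <> w (inord i.+2) :> nat].
  by split; apply: w_neq; lia.
(* Of the eight sign patterns two are cyclic, hence contradictory; the other six are the orders of
   three distinct values. *)
case: (ltngtP (w (inord i)) (w (inord i.+1))) w01 => // lt01 _;
case: (ltngtP (w (inord i)) (w (inord i.+2))) w02 => // lt02 _;
case: (ltngtP (w (inord i.+1)) (w (inord i.+2))) w12 => // lt12 _;
  try lia; ring.
Qed.

(** Strict increase gives x <= w x for every x; both sides have the same sum, so equality holds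
    throughout. *)
Lemma no_descent_perm1 (w : perms) :
  (forall i, (i < N)%N -> (w (inord i) < w (inord i.+1))%N) -> w = 1%g.
Proof.
move=> asc; have le_w (x : 'I_N.+1) : (x <= w x)%N.
  rewrite -(inord_val x) inordK //; elim: (val x) (ltn_ord x) => // i IHi lti.
  exact: leq_ltn_trans (IHi (ltnW lti)) (asc i lti).
have [_ eq_w] := leqif_sum (fun x (_ : true) => leqif_eq (le_w x)).
have sumE : (\sum_(x < N.+1) w x)%N = (\sum_(x < N.+1) x)%N.
  by rewrite [RHS](reindex_inj (@perm_inj _ w)).
apply/permP => x; rewrite perm1; apply/val_inj/esym/eqP.
by move: eq_w; rewrite sumE eqxx => /esym/forallP/(_ x).
Qed.

(** As in the rearrangement inequality, sorting a descent increases this sum; its distance to an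
    upper bound is the induction measure, in place of the number of inversions. *)
Definition weight (w : perms) := (\sum_(x < N.+1) x * w x)%N.

Lemma weight_swap i (w : perms) : (i < N)%N ->
  (w (inord i.+1) < w (inord i))%N -> (weight w < weight (swap i * w)%g)%N.
Proof.
move=> lti desc; rewrite /weight [X in (_ < X)%N](reindex_inj (@perm_inj _ (swap i))).
have ij : inord i.+1 != inord i :> 'I_N.+1 by apply: inord_neq; lia.
have sumE (h : 'I_N.+1 -> nat) : (\sum_x h x)%N = (h (inord i) + (h (inord i.+1) +
    \sum_(x | (x != inord i) && (x != inord i.+1)) h x))%N.
  by rewrite (bigD1 (inord i)) //= (bigD1 (inord i.+1)).
rewrite [X in (X < _)%N]sumE [X in (_ < X)%N]sumE !permM.
rewrite !swapL !swapR !swapL !inordK; try lia.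
rewrite [X in (_ < _ + (_ + X))%N](eq_bigr (fun x : 'I_N.+1 => x * w x)%N)
  => [|x /andP[xi xi1]]; last first.
  by rewrite permM /swap !tpermD // eq_sym.
set S := (\sum_(x | _) _)%N; move: desc.
move: (nat_of_ord (w _)) (nat_of_ord (w _)) => a b; nia.
Qed.

Lemma weight_le (w : perms) : (weight w <= N.+1 * (N * N))%N.
Proof.
rewrite -[N.+1 in leqRHS]card_ord -sum_nat_const; apply: leq_sum => x _.
by rewrite leq_mul // -ltnS.
Qed.

(** Undoing a descent raises the bounded weight, and only the identity has no descent. Read
    backwards, ascents lead from the identity to every permutation. *)
Lemma ascent_ind (P : perms -> Prop) : P 1%g ->
    (forall i (w : perms), (i < N)%N -> (w (inord i) < w (inord i.+1))%N -> P w ->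
      P (swap i * w)%g) ->
  forall w, P w.
Proof.
move=> P1 PS w; have [k] := ubnP (N.+1 * (N * N) - weight w).
elim: k w => // k IHk w; rewrite ltnS => le_k.
have [i|asc] := pickP (fun i : 'I_N => w (inord i.+1) < w (inord i))%N.
  move=> desc; rewrite -(swapK i w); apply: PS => //.
    by rewrite !permM swapL swapR.
  apply: IHk; apply: leq_trans le_k; have := weight_swap (ltn_ord i) desc.
  by have := weight_le (swap i * w)%g; lia.
rewrite (@no_descent_perm1 w) // => i lti; have /negbT := asc (Ordinal lti).
rewrite /= -leqNgt leq_eqVlt => /predU1P[/val_inj/perm_inj/eqP|//].
by apply/contraTT => _; apply: inord_neq; lia.
Qed.

Definition delta (w : perms) : V := [ffun u => (u == w)%:R].

Lemma hecke_act_delta i (w : perms) : (w (inord i) < w (inord i.+1))%N ->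
  hecke_act i (delta w) = delta (swap i * w)%g.
Proof.
move=> asc; apply/ffunP => u; rewrite !ffunE.
have -> : (u == swap i * w)%g = (swap i * u == w)%g.
  by rewrite -(inj_eq (mulgI (swap i))) swapK.
case: ifP => ltu; last first.
  by case: (u =P w) ltu => [->|_ _]; [rewrite asc | rewrite mulr0 addr0].
case: eqP => [wE|_]; last by rewrite mulr0.
by move: asc; rewrite -wE !permM swapL swapR; lia.
Qed.

(* Only ascents are used, since the operators are singular when q = 0. *)
Lemma delta_orbit (A : nzRingType) (g : nat -> A) (Phi : A -> V) (S : A -> Prop) :
    Phi 1 = delta 1%g ->
    (forall i u, (i < N)%N -> Phi (g i * u) = hecke_act i (Phi u)) ->
    S 1 -> (forall i u, (i < N)%N -> S u -> S (g i * u)) ->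
  forall w, exists2 u, S u & Phi u = delta w.
Proof.
move=> Phi1 PhiM S1 SM; apply: ascent_ind => [|i w lti asc [u Su uE]].
  by exists 1.
by exists (g i * u); [apply: SM | rewrite PhiM // uE hecke_act_delta].
Qed.

End PermutationModule.

(** The images of the entries of [s ++ t] span all functions and number [#|I|], so they form a
    basis; a dependence within [s] would map to one within this basis. Dimensions are counted only
    in the target. *)
Lemma ffun_spanning_free (F : fieldType) (I : finType) (A : lmodType F)
    (Phi : A -> {ffun I -> F^o}) (s t : seq A) :
    linear Phi -> size (s ++ t) = #|I| ->
    (forall i, exists2 u, in_span (s ++ t) u & Phi u = [ffun j => (j == i)%:R]) ->
  forall a : 'I_(size s) -> F, \sum_i a i *: s`_i = 0 -> forall i, a i = 0.
Proof.
move=> PhiL sz_st Phi_onto.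
have Pst : free (map Phi (s ++ t)).
  apply: (@basis_free _ _ fullv); rewrite basisEdim dimvf size_map sz_st.
  rewrite /dim /= muln1 leqnn andbT; apply/subvP => v _.
  have -> : v = \sum_i v i *: [ffun j => (j == i)%:R].
    apply/ffunP => j; rewrite sum_ffunE (bigD1 j) //= big1 => [|i ij].
      by rewrite !ffunE eqxx addr0 /GRing.scale /= mulr1.
    by rewrite !ffunE eq_sym (negPf ij) scaler0.
  apply: memv_suml => i _; apply: memvZ; have [u [a ->] <-] := Phi_onto i.
  rewrite (linear_combination PhiL); apply: memv_suml => k _; apply/memvZ/memv_span.
  by apply/map_f/mem_nth.
move: Pst; rewrite map_cat => /catl_free Ps a sa0.
apply: (freeP (X := map_tuple Phi (in_tuple s)) Ps).
rewrite -[RHS](linear0_of PhiL) -sa0 (linear_combination PhiL).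
by apply: eq_bigr => i _; rewrite (nth_map 0).
Qed.

(** * The dimension *)

Section Dimension.
Variables (F : fieldType) (q : F) (N : nat) (A : algType F) (g : nat -> A).
Hypotheses (q1 : q + 1 != 0) (two_neq0 : (2 : F) != 0) (N_gt0 : (0 < N)%N).
Hypothesis g_sq : forall i, (i < N)%N -> g i * g i = (q - 1) *: g i + q *: 1.
Hypothesis g_braid : forall i, (i.+1 < N)%N ->
  g i * g i.+1 * g i = g i.+1 * g i * g i.+1.
Hypothesis g_comm : forall i j, (i.+1 < j)%N -> (j < N)%N -> g i * g j = g j * g i.

Variable Phi : A -> {ffun {perm 'I_N.+1} -> F^o}.
Hypotheses (Phi_linear : linear Phi) (Phi1 : Phi 1 = delta F 1%g).
Hypothesis PhiM : forall i u, (i < N)%N -> Phi (g i * u) = hecke_act q i (Phi u).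

Let f i := involution q (g i).
Let y := (q - 1) / (q + 1).

Variable gens : set A.
Hypothesis gensP : forall x, gens x <->
  exists j, [/\ (0 < j)%N, (j < N)%N & x = f 0%N * f j].

Lemma has_dim_even_part :
  has_dim (smallest (fun B => GRing.subalg_closed (mem B)) gens) (N.+1`! %/ 2).
Proof.
have f_sq i : (i < N)%N -> f i * f i = 1.
  by move=> lti; apply: involution_sq => //; apply: g_sq.
have f_braid i : (i.+1 < N)%N ->
    f i.+1 * f i * f i.+1 = f i * f i.+1 * f i + (y * y) *: (f i - f i.+1).
  move=> lti; apply: involution_braid => //; last exact: g_braid.
    by apply: g_sq; lia.
  exact: g_sq.
have f_comm i j : (i.+1 < j)%N -> (j < N)%N -> f i * f j = f j * f i.
  by move=> ltij ltj; apply: involution_comm; apply: g_comm.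
set s := normal_forms f N false; set t := normal_forms f N true.
(* [N_gt0] enters here, because the two parities differ in size at level 0. *)
have sz b : (size (normal_forms f N b)).*2 = N.+1`!.
  by case: N N_gt0 => // M _; apply: size_normal_forms.
have -> : (N.+1`! %/ 2)%N = size s by rewrite -(sz false) -muln2 mulnK.
have st_sub b x : in_span (normal_forms f N b) x -> in_span (s ++ t) x.
  apply: sub_in_span => u us; rewrite mem_cat.
  by case: b us => us; rewrite us ?orbT.
have PS := span_subspace (s ++ t).
have st_f i u : (i < N)%N -> in_span (s ++ t) u -> in_span (s ++ t) (f i * u).
  move=> lti; apply: (@in_span_min _ _ _ (fun x => in_span _ (f i * x))).
    exact: subspace_mull.
  by move=> x; rewrite mem_cat => /orP[] /mem_in_span;
     move=> /(span_f f_sq f_braid f_comm (leqnn N) lti)/st_sub.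
have st_g i u : (i < N)%N -> in_span (s ++ t) u -> in_span (s ++ t) (g i * u).
  move=> lti us.
  (* Solves the definition of [f i] for [g i]; this is where 2 must be invertible. *)
  have -> : g i * u = ((q + 1) / 2) *: (y *: u + f i * u).
    have -> : y *: u + f i * u = (f i + y *: 1) * u.
      by rewrite mulrDl -(scalerAl y) mul1r addrC.
    rewrite involutionK -scalerAl scalerA.
    rewrite (_ : _ / _ * _ = 1) ?scale1r //; field.
    by rewrite q1 two_neq0.
  by apply: subspaceZ => //; case: PS => _; apply=> //; apply: st_f.
(* The combined span contains 1 and is stable under the [g i], so it contains preimages of all delta
   functions. *)
have onto i : exists2 u, in_span (s ++ t) u & Phi u = [ffun j => (j == i)%:R].
  apply: (delta_orbit Phi1 PhiM _ st_g).
  by apply: (@st_sub false); apply: span1.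
have s_free := ffun_spanning_free Phi_linear _ onto.
exists (fun i => s`_i); split=> [a|x].
  apply: s_free; rewrite size_cat card_Sn.
  by apply: double_inj; rewrite doubleD !sz addnn.
exact: (altE f_sq f_braid f_comm gensP x).
Qed.

End Dimension.

Lemma hecke_module (F : fieldType) (N : nat) (q : F) :
  exists Phi : hecke N.+1 q -> {ffun {perm 'I_N.+1} -> F^o},
    [/\ linear Phi, Phi 1 = delta F 1%g &
        forall (i : 'I_N.+1.-1) u, Phi (hecke_g q i * u) = hecke_act q i (Phi u)].
Proof.
pose T (i : 'I_N.+1.-1) := @hecke_act F q N i.
have TL i : linear (T i) by exact: hecke_act_linear.
apply: (pres_module TL (rels := hecke_rels N.+1 q) (delta F 1%g)).
move=> r v [[[i ->]|[i [j [ij ->]]]]|[i [j [ij ->]]]]; rewrite malg_actB.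
- rewrite expr2 malg_act_linear malg_actZ malg_act1.
  rewrite (malg_act_gen2 TL) malg_act_gen.
  by rewrite /T hecke_act_sq ?subrr.
- apply/eqP; rewrite subr_eq0; apply/eqP.
  apply: (etrans (malg_act_gen3 TL i j i v)).
  apply: (etrans _ (esym (malg_act_gen3 TL j i j v))).
  by rewrite /T ij hecke_act_braid // -ij; apply: ltn_ord.
- apply/eqP; rewrite subr_eq0; apply/eqP.
  apply: (etrans (malg_act_gen2 TL i j v)).
  apply: (etrans _ (esym (malg_act_gen2 TL j i v))).
  by rewrite /T hecke_act_comm //; apply: ltn_ord.
Qed.

Theorem theorem5p3 (R : realType) (n : nat) (q : R[i]) :
  (2 <= n)%N -> q != -1 -> has_dim (alt_hecke n q) (n`! %/ 2)%N.
Proof.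
(* With n = M + 2 there are N = M + 1 generators, so the permutations of N + 1 points are those of n
   points. *)
case: n => [|[|M]] // _ qN1; have q1 : q + 1 != 0 by rewrite addr_eq0.
have two_neq0 : (2 : R[i]) != 0 by rewrite Num.Theory.pnatr_eq0.
have [Phi [PhiL Phi1 PhiM]] := hecke_module M.+1 q.
(* Makes the generators a family over all natural numbers; the default value of [inord] is never met
   below [M.+1]. *)
pose idx i : 'I_M.+2.-1 := inord i : 'I_M.+1.
have idxE i : (i < M.+1)%N -> idx i = i :> nat by exact: inordK.
pose g i : hecke M.+2 q := hecke_g q (idx i).
have := @has_dim_even_part _ q M.+1 (hecke M.+2 q) g q1 two_neq0 isT _ _ _ Phi PhiL Phi1 _
  (alt_hecke_gens M.+2 q).
apply.
- by move=> i lti; apply: hecke_g_sq.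
- by move=> i lti; apply: hecke_g_braid; rewrite !idxE //; lia.
- by move=> i j ltij ltj; apply: hecke_g_comm; rewrite !idxE //; lia.
- by move=> i u lti; apply: etrans (PhiM _ _) _; rewrite idxE.
move=> x; split=> [[i [j [i0 j0 ->]]]|[j [j0 ltj ->]]].
  have iE : i = idx 0 by apply/val_inj/(etrans i0)/esym/idxE.
  have jE : j = idx j by apply/val_inj/esym/idxE/ltn_ord.
  exists j; split; [exact: j0 | exact: ltn_ord |].
  exact: (congr2 (fun i j => hecke_f q i * hecke_f q j) iE jE).
exists (idx 0), (idx j); split; [exact: idxE | by rewrite idxE | reflexivity].
Qed.
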